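(* Let $G$ be a finitely generated group and $S$ a nonempty finite set. Let $T$ be the right shift action of $G$ on $S^G$, given by $(T_gx)_h=x_{hg}$ for $g,h\in G$, $x\in S^G$, and let $X\subset S^G$ be a subshift. Then $X$ is of finite type if and only if the action $T$ restricted to $X$ has the pseudo-orbit tracing property (POTP).
   Context: $S^G=\prod_G S$ carries the product topology (with $S$ discrete). A subshift is a closed $G$-invariant subset $X$ of $S^G$. For a nonempty finite $F\subset G$, $\pi_F:S^G\to S^F$ is the restriction map. A subshift $X$ is of finite type if there are a nonempty finite subset $F$ of $G$ and a subset $P\subset S^F$ such that $X=\{x\in S^G:\pi_F(T_gx)\in P\ \text{for all } g\in G\}$. POTP: Let $T$ be a continuous action of a finitely generated group $G$ on a compact metrizable space $X$, let $d$ be a compatible metric on $X$, and let $A$ be a finite generating set of $G$. For $\delta>0$, a $\delta$ pseudo-orbit of $T$ with respect to $A$ is a family $\{x^{(g)}\}_{g\in G}$ in $X$ with $d(T_ax^{(g)},x^{(ag)})<\delta$ for all $a\in A$, $g\in G$. $T$ has POTP (with respect to $A$) if for every $\varepsilon>0$ there is $\delta>0$ such that for every $\delta$ pseudo-orbit $\{x^{(g)}\}_{g\in G}$ of $T$ with respect to $A$ there is $x\in X$ with $d(T_gx,x^{(g)})<\varepsilon$ for all $g\in G$. This property does not depend on the choice of compatible metric $d$ or of finite generating set $A$, and one says $T$ has POTP if it holds for some such choice. *)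

(* Defs.v *)
From mathcomp Require Import all_boot all_order all_algebra.
From mathcomp Require Import all_classical reals topology.

Set Implicit Arguments.
Unset Strict Implicit.
Unset Printing Implicit Defensive.

Import Order.TTheory GRing.Theory Num.Theory.

Local Open Scope classical_set_scope.
Local Open Scope ring_scope.

(* Generation as a group: inverses of elements of A are available, and A itself
   is not assumed to be symmetric. *)
Definition generates (G : groupType) (A : set G) : Prop :=
  forall H : set G, group_closed [in H] -> A `<=` H -> H = setT.

Definition finitely_generated (G : groupType) : Prop :=
  exists A : set G, finite_set A /\ generates A.

Record continuous_action (G : groupType) (Y : topologicalType) := ContinuousAction {
  act :> G -> Y -> Y;
  act1 : forall x, act 1%g x = x;
  actM : forall g h x, act (g * h)%g x = act g (act h x);
  act_continuous : forall g, continuous (act g) }.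

Definition invariant_set (G : groupType) (Y : topologicalType)
    (T : continuous_action G Y) (X : set Y) : Prop :=
  forall g x, X x -> X (T g x).

(* X is used as the sigma type [set_type X], whose library topology is the
   subspace topology, i.e. the initial one for [set_val]. *)
Section Restriction.
Variables (G : groupType) (Y : topologicalType) (T : continuous_action G Y).
Variables (X : set Y) (invX : invariant_set T X).

Definition restrict_fun (g : G) (x : X) : X :=
  SigSub (mem_set (invX g (set_mem (valP x)))).

Fact restrict_fun1 x : restrict_fun 1%g x = x.
Proof. by apply: val_inj; rewrite /= act1. Qed.

Fact restrict_funM g h x :
  restrict_fun (g * h)%g x = restrict_fun g (restrict_fun h x).
Proof. by apply: val_inj; rewrite /= actM. Qed.

Fact restrict_fun_continuous g : continuous (restrict_fun g).
Proof.
apply: continuous_comp_initial => x.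
apply: (@continuous_comp _ _ _ (set_val : X -> Y) (T g)).
  exact: initial_continuous.
exact: act_continuous.
Qed.

Definition restrict_action : continuous_action G X :=
  ContinuousAction restrict_fun1 restrict_funM restrict_fun_continuous.

End Restriction.

Definition is_metric (R : realType) (Y : Type) (d : Y -> Y -> R) : Prop :=
  [/\ forall x y, 0 <= d x y,
      forall x y, d x y = 0 <-> x = y,
      forall x y, d x y = d y x &
      forall x y z, d x z <= d x y + d y z].

Definition compatible_metric (R : realType) (Y : topologicalType)
    (d : Y -> Y -> R) : Prop :=
  is_metric d /\
  forall (x : Y) (U : set Y),
    nbhs x U <-> exists2 e : R, 0 < e & [set y | d x y < e] `<=` U.

Section PseudoOrbitTracing.
Variables (R : realType) (G : groupType) (Y : topologicalType).
Implicit Types (T : continuous_action G Y) (d : Y -> Y -> R) (A : set G).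

Definition pseudo_orbit T d A (delta : R) (x : G -> Y) : Prop :=
  forall a g, A a -> d (T a (x g)) (x (a * g)%g) < delta.

Definition POTP_wrt T d A : Prop :=
  forall eps : R, 0 < eps -> exists2 delta : R, 0 < delta &
    forall x : G -> Y, pseudo_orbit T d A delta x ->
      exists z : Y, forall g, d (T g z) (x g) < eps.

(* On a compact space the property does not depend on d and A, hence the
   existential quantifiers. *)
Definition POTP T : Prop :=
  exists d A, [/\ compatible_metric d, finite_set A, generates A & POTP_wrt T d A].

End PseudoOrbitTracing.

Arguments POTP R {G Y} T.

Definition full_shift (G : groupType) (S : finType) : topologicalType :=
  {ptws G -> discrete_topology S}.

Section Shift.
Variables (G : groupType) (S : finType).

Definition shift_fun (g : G) (x : full_shift G S) : full_shift G S :=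
  fun h => x (h * g)%g.

Fact shift_fun1 x : shift_fun 1%g x = x.
Proof. by apply/funext => h; rewrite /shift_fun mulg1. Qed.

Fact shift_funM g h x : shift_fun (g * h)%g x = shift_fun g (shift_fun h x).
Proof. by apply/funext => k; rewrite /shift_fun mulgA. Qed.

Fact shift_fun_continuous g : continuous (shift_fun g).
Proof.
move=> x; have FF : Filter (shift_fun g @ nbhs x).
  by apply: fmap_filter; apply: nbhs_filter.
apply/cvg_sup => h.
apply: (@continuous_comp_initial _ _ (discrete_topology S)
  (fun f : G -> discrete_topology S => f h) (shift_fun g)) => y.
exact: (@proj_continuous G (fun=> discrete_topology S) (h * g)%g y).
Qed.

Definition shift : continuous_action G (full_shift G S) :=
  ContinuousAction shift_fun1 shift_funM shift_fun_continuous.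

Definition subshift (X : set (full_shift G S)) : Prop :=
  closed X /\ invariant_set shift X.

Definition pattern (F : set G) (x : full_shift G S) : F -> S :=
  fun h => x (set_val h).

Definition finite_type (X : set (full_shift G S)) : Prop :=
  exists (F : set G) (P : set (F -> S)),
    [/\ finite_set F, F !=set0 & X = [set x | forall g, P (pattern (shift g x))]].

End Shift.

(* Main.v *)
Require Import Defs.
From mathcomp Require Import all_boot all_order all_algebra.
From mathcomp Require Import finmap.
From mathcomp Require Import all_classical reals topology.

(** A point of a subshift is determined by its coordinates at the identity
    along its orbit, since [(T_g x)_1 = x_g].  Both directions rest on this and
    on the fact that closeness in [X] means agreement on a large finite subset
    of [G].

    Finite type implies POTP.  Let [x] be a pseudo-orbit that is accurate on
    sufficiently many coordinates.  The only candidate for a traced point is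
    [z_g = (x^(g))_1].  Following the pseudo-orbit along generators transports
    coordinates, [(x^(g))_(hk) = (x^(kg))_h], so [(T_g z)_k = (x^(g))_k] for all
    [k] in a prescribed finite set ([pseudo_orbit_coordinate]).  When this set
    contains the window of the defining patterns, every window of [z] is a
    window of some [x^(g)] in [X], hence allowed, and [z] is in [X]; when it
    also controls the metric, [z] traces [x].  This is done for one explicit
    metric, for which agreement on the members of an exhaustion of [G] by
    finite sets is exactly what small distance means ([shift_distP]).

    POTP implies finite type.  Here the metric is arbitrary, and compactness of
    [X] supplies the comparison with coordinates in both directions
    ([uniform_coordinate], [uniform_cylinder]): distance below some [eps] forces
    equality at the identity, and agreement on some finite [K] forces distance
    below the [delta] that POTP gives for [eps].  The allowed patterns are those
    of [X] on [K] together with [K A].  If all windows of [x] are allowed, points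
    of [X] with the same windows as the translates of [x] form a [delta]
    pseudo-orbit, and a point of [X] that traces it has to be [x]. *)

Set Implicit Arguments.
Unset Strict Implicit.
Unset Printing Implicit Defensive.

Import Order.TTheory GRing.Theory Num.Theory.

Local Open Scope classical_set_scope.
Local Open Scope ring_scope.

(** * A metric from a decreasing sequence of equivalence relations *)

Section UltrametricOfEquivalences.
Variables (R : realType) (Y : Type) (e : nat -> Y -> Y -> Prop).
Hypothesis e_refl : forall n x, e n x x.
Hypothesis e_sym : forall n x y, e n x y -> e n y x.
Hypothesis e_trans : forall n x y z, e n x y -> e n y z -> e n x z.
Hypothesis e_le : forall m n x y, (m <= n)%N -> e n x y -> e m x y.
Hypothesis e_sep : forall x y, (forall n, e n x y) -> x = y.

(** The value is [1 / (m + 1)] for the least [m] at which [x] and [y] are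
    inequivalent; the index is shifted so that level 0 gives 1. *)
Definition level_dist (x y : Y) : R :=
  if pselect (exists n, `[< ~ e n x y >]) is left h
  then (ex_minn h).+1%:R^-1 else 0.

(** All metric properties are read off from this equivalence: together with
    [level_dist_value] it reduces each inequality between distances to a property
    of the relations. *)
Lemma level_distP n x y : level_dist x y < n.+1%:R^-1 <-> e n x y.
Proof.
rewrite /level_dist; case: pselect => [h|h]; last first.
  split=> _; last by rewrite invr_gt0 ltr0n.
  by apply: contrapT => ne; apply: h; exists n; apply/asboolP.
case: ex_minnP => m /asboolP nem mmin.
rewrite ltf_pV2 ?posrE ?ltr0n// ltr_nat ltnS; split.
  move=> nm; apply: contrapT => /asboolP /mmin mn.
  by move: (leq_trans nm mn); rewrite ltnn.
move=> en; rewrite ltnNge; apply/negP => mn.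
by apply: nem; exact: e_le en.
Qed.

Lemma level_dist_ge0 x y : 0 <= level_dist x y.
Proof. by rewrite /level_dist; case: pselect => // h; rewrite invr_ge0 ler0n. Qed.

Lemma level_dist_value x y :
  level_dist x y = 0 \/ exists m, level_dist x y = m.+1%:R^-1.
Proof.
by rewrite /level_dist; case: pselect => h; [right; eexists|left].
Qed.

Lemma level_dist_metric : is_metric level_dist.
Proof.
have refl0 x : level_dist x x = 0.
  case: (level_dist_value x x) => // -[m dm].
  by have := e_refl m x; rewrite -level_distP dm ltxx.
split=> [x y|x y|x y|x y z]; first exact: level_dist_ge0.
- split=> [d0|->//]; apply: e_sep => n.
  by apply/level_distP; rewrite d0 invr_gt0 ltr0n.
- wlog suff: x y / level_dist x y <= level_dist y x.
    by move=> le; apply/eqP; rewrite eq_le !le.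
  case: (level_dist_value x y) => [->|[m dm]]; first exact: level_dist_ge0.
  rewrite leNgt dm; apply/negP => /level_distP/e_sym/level_distP.
  by rewrite dm ltxx.
(* Otherwise both d x y and d y z are below d x z = 1 / (m + 1), so x and z are
   equivalent at level m, which makes d x z smaller than itself. *)
- case: (level_dist_value x z) => [->|[m dm]].
    by rewrite addr_ge0// level_dist_ge0.
  rewrite leNgt; apply/negP => lt.
  have : level_dist x z < m.+1%:R^-1.
    apply/level_distP/(@e_trans _ _ y); apply/level_distP; rewrite -dm;
    apply: le_lt_trans lt.
      by rewrite lerDl level_dist_ge0.
    by rewrite lerDr level_dist_ge0.
  by rewrite dm ltxx.
Qed.

Lemma level_dist_lt (eps : R) : 0 < eps ->
  exists n, forall x y, e n x y -> level_dist x y < eps.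
Proof.
move=> eps0; have [n neps] := ltr_add_invr eps0.
exists n => x y /level_distP xy; apply: lt_trans xy _.
by move: neps; rewrite add0r.
Qed.

End UltrametricOfEquivalences.

(** * Exhausting a finitely generated group by finite sets *)

Section Exhaustion.
Variables (G : groupType) (A : set G).

(** Taking quotients, rather than products with a symmetrized [A], makes the
    union closed under the group operations at once; the presence of the
    identity makes the sequence increasing. *)
Fixpoint exhaustion (n : nat) : set G :=
  if n is m.+1 then
    [set (p.1 * p.2^-1)%g | p in exhaustion m `*` exhaustion m]
  else 1%g |` A.

Lemma exhaustion1 n : exhaustion n 1%g.
Proof.
elim: n => [|n IH] /=; first by left.
by exists (1%g, 1%g) => //=; rewrite invg1 mulg1.
Qed.

Lemma exhaustionS n : exhaustion n `<=` exhaustion n.+1.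
Proof.
move=> x xn; exists (x, 1%g); last by rewrite /= invg1 mulg1.
by split=> //; exact: exhaustion1.
Qed.

Lemma exhaustion_le m n : (m <= n)%N -> exhaustion m `<=` exhaustion n.
Proof.
move=> /subnKC <-; elim: (n - m)%N => [|k IH]; first by rewrite addn0.
by rewrite addnS; apply: subset_trans IH (@exhaustionS _).
Qed.

Lemma exhaustion_finite n : finite_set A -> finite_set (exhaustion n).
Proof.
move=> fA; elim: n => [|n IH] /=; first by rewrite finite_setU; split.
by apply: finite_image; apply: finite_setX.
Qed.

Lemma exhaustion_cover h : generates A -> exists n, exhaustion n h.
Proof.
move=> genA; suff : (\bigcup_n exhaustion n) h by case=> n _; exists n.
rewrite (genA (\bigcup_n exhaustion n)) //; last by move=> a Aa; exists 0%N => //; right.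
split; first by rewrite unfold_in/= in_setE; exists 0%N => //; exact: exhaustion1.
move=> x y; rewrite !unfold_in /= !in_setE => -[m _ xm] [n _ yn].
exists (maxn m n).+1 => //; exists (x, y) => //; split.
  by apply: exhaustion_le xm; exact: leq_maxl.
by apply: exhaustion_le yn; exact: leq_maxr.
Qed.

End Exhaustion.

(** * Cylinders and the topology of a subshift *)

Lemma filter_finite_set (T I : choiceType) (Fl : set_system T) (D : set I)
    (Q : I -> T -> Prop) : Filter Fl -> finite_set D ->
  (forall i, D i -> Fl (Q i)) -> Fl [set t | forall i, D i -> Q i t].
Proof.
move=> FF /finite_fsetP[D' ->] FQ.
suff -> : [set t | forall i, i \in D' -> Q i t] = \bigcap_(i in [set i | i \in D']) Q i.
  exact: filter_bigI.
by apply/seteqP; split.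
Qed.

Section Cylinders.
Variables (G : groupType) (S : finType) (E : nat -> set G).
Hypothesis E_le : forall m n, (m <= n)%N -> E m `<=` E n.
Hypothesis E_finite : forall n, finite_set (E n).
Hypothesis E_cover : forall h, exists n, E n h.

Definition agree (F : set G) (x y : full_shift G S) : Prop :=
  forall h, F h -> x h = y h.

Lemma nbhs_coordinate (x : full_shift G S) h :
  nbhs x [set y : full_shift G S | x h = y h].
Proof.
have : nbhs x (proj h @^-1` [set x h]).
  apply: (@proj_continuous G (fun=> discrete_topology S) h x).
  exact: (discrete_set1 (x h : discrete_topology S)).
by apply: filterS => y /= <-.
Qed.

Lemma nbhs_agree (F : set G) (x : full_shift G S) :
  finite_set F -> nbhs x (agree F x).
Proof.
by move=> fF; apply: filter_finite_set => // h _; exact: nbhs_coordinate.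
Qed.

(** For the direct implication, the filter generated by the cylinders converges
    to [x] because it does so coordinatewise, hence it contains every
    neighbourhood of [x]. *)
Lemma nbhs_cylinder (x : full_shift G S) U :
  nbhs x U <-> exists n, agree (E n) x `<=` U.
Proof.
split=> [xU|[n nU]]; last exact: filterS nU (nbhs_agree x (E_finite n)).
pose C : set_system (full_shift G S) :=
  filter_from setT (fun n => agree (E n) x).
have CF : Filter C.
  apply: filter_from_filter; first by exists 0%N.
  move=> m n _ _; exists (maxn m n) => // y xy; split=> h hE; apply: xy.
    by apply: E_le hE; exact: leq_maxl.
  by apply: E_le hE; exact: leq_maxr.
suff : C --> x by move=> /(_ _ xU)[n _ nU]; exists n.
apply/cvg_sup => h V [_ [[W _ <-] Wx WV]].
have [n nh] := E_cover h.
by exists n => // y /(_ _ nh) xyh; apply: WV; rewrite /= -xyh.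
Qed.

Variable X : set (full_shift G S).

Lemma nbhs_subshift_cylinder (x : X) (U : set X) :
  nbhs x U <-> exists n, forall y : X, agree (E n) (val x) (val y) -> U y.
Proof.
split=> [[_ [[V oV <-] Vx VU]]|[n nU]].
  have /nbhs_cylinder[n nV] : nbhs (val x) V by apply: open_nbhs_nbhs.
  by exists n => y /nV; exact: VU.
have : nbhs x (set_val @^-1` agree (E n) (val x)).
  by apply: (@initial_continuous X _ set_val x); exact: nbhs_agree.
by apply: filterS => y; exact: nU.
Qed.

Lemma compact_full_shift : compact [set: full_shift G S].
Proof.
have cS : compact [set: discrete_topology S].
  by apply: finite_compact; exact: (@finite_finset S setT).
have := @tychonoff G (fun=> discrete_topology S) (fun=> setT) (fun=> cS).
by congr (compact _); apply/seteqP; split.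
Qed.

(** Compactness of [X] as a local-to-global principle: a property indexed by a
    threshold [n] that holds locally from some threshold on holds on all of [X]
    at a common one. *)
Lemma subshift_uniform (P : nat -> X -> Prop) : closed X ->
  (forall x : X, exists n, forall y : X, agree (E n) (val x) (val y) ->
     forall m, (n <= m)%N -> P m y) ->
  exists n, forall y, P n y.
Proof.
move=> cX localP.
have cptX : compact X by apply: subclosed_compact cX compact_full_shift _.
(* The covering principle speaks of points of the full shift, so membership in X
   is quantified inside the predicate. *)
have := (compact_near_coveringP X).1 cptX nat \oo
  (fun n y => forall Xy : y \in X, P n (SigSub Xy)) _.
case=> [x Xx|n _ nP].
  have [n nP] := localP (SigSub (mem_set Xx)).
  exists (agree (E n) x, [set m | (n <= m)%N]) => [|[y m] [/= xy nm] Xy].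
    split; first exact: nbhs_agree.
    by exists n.
  exact: nP.
exists n => -[y Xy]; exact: (nP n (leqnn n) y (set_mem Xy)).
Qed.

End Cylinders.

(** * Subshifts of finite type have POTP *)

Section FiniteTypeToPOTP.
Variables (R : realType) (G : groupType) (S : finType).
Variables (A : set G) (finA : finite_set A) (genA : generates A).
Variables (X : set (full_shift G S)) (invX : invariant_set (shift G S) X).
Let T := restrict_action invX.

Definition ball_agree (n : nat) (x y : X) : Prop :=
  agree (exhaustion A n) (val x) (val y).

Definition shift_dist : X -> X -> R := level_dist R ball_agree.

Lemma ball_agree_le m n x y : (m <= n)%N -> ball_agree n x y -> ball_agree m x y.
Proof. by move=> mn xy h hm; apply: xy; exact: exhaustion_le hm. Qed.

Lemma shift_distP n x y : shift_dist x y < n.+1%:R^-1 <-> ball_agree n x y.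
Proof. exact/level_distP/ball_agree_le. Qed.

Lemma shift_dist_compatible : compatible_metric shift_dist.
Proof.
split.
  apply: level_dist_metric => //.
  - by move=> n x y xy h /xy.
  - by move=> n x y z xy yz h hn; rewrite xy// yz.
  - exact: ball_agree_le.
  - move=> x y xy; apply/val_inj/funext => h.
    by have [n nh] := exhaustion_cover h genA; exact: xy nh.
move=> x U; rewrite (nbhs_subshift_cylinder (@exhaustion_le _ A)
  (fun n => exhaustion_finite n finA) (fun h => exhaustion_cover h genA)).
split=> [[n nU]|[eps eps0 epsU]].
  exists n.+1%:R^-1; first by rewrite invr_gt0 ltr0n.
  by move=> y /shift_distP; exact: nU.
have [n n_eps] := level_dist_lt ball_agree_le eps0.
by exists n => y /n_eps; exact: epsU.
Qed.

(** A single generator costs nothing but a small [delta], by definition of a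
    pseudo-orbit.  The [k] for which the claim holds for all [h] form a subgroup:
    stating it for every [h], and for every base point [g], lets it be used
    backwards, which handles inverses although [A] is not symmetric. *)
Lemma pseudo_orbit_coordinate k h : \forall n \near \oo, forall x : G -> X,
  pseudo_orbit T shift_dist A n.+1%:R^-1 x ->
  forall g, val (x g) (h * k)%g = val (x (k * g)%g) h.
Proof.
pose H : set G := [set k | forall h, \forall n \near \oo, forall x : G -> X,
  pseudo_orbit T shift_dist A n.+1%:R^-1 x ->
  forall g, val (x g) (h * k)%g = val (x (k * g)%g) h].
suff HT : H = setT by have : H k by rewrite HT.
apply: genA => [|a Aa {}h]; last first.
  have [n nh] := exhaustion_cover h genA.
  exists n => // m nm x /(_ a _ Aa) xm g; have /shift_distP := xm g; apply.
  exact: exhaustion_le nm _ nh.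
have H1 : H 1%g by move=> h0; apply: nearW => n x _ g; rewrite mulg1 mul1g.
split; first by rewrite unfold_in/= in_setE.
move=> k1 k2; rewrite !unfold_in/= !in_setE => Hk1 Hk2 {}h.
apply: filterS2 (Hk1 h) (Hk2 (h * k1 * k2^-1)%g) => n n1 n2 x xn g.
(* The claim for k2 at base point k2^-1 g, read from right to left. *)
have := n2 x xn (k2^-1 * g)%g; rewrite mulgA mulgV mul1g mulgVK.
by rewrite -mulgA => <-; rewrite n1// mulgA.
Qed.

Lemma finite_type_POTP : finite_type X -> POTP R T.
Proof.
case=> F [P [finF _ defX]]; exists shift_dist, A.
split=> //; first exact: shift_dist_compatible.
move=> eps eps0; have [n n_eps] := level_dist_lt ball_agree_le eps0.
(* Agreement on exhaustion A n makes z trace x, agreement on F puts z in X. *)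
have finK : finite_set (exhaustion A n `|` F).
  by rewrite finite_setU; split=> //; exact: exhaustion_finite.
have [N _ /(_ N (leqnn N)) NK] := filter_finite_set _ finK
  (fun k _ => pseudo_orbit_coordinate k 1%g).
exists N.+1%:R^-1; first by rewrite invr_gt0 ltr0n.
move=> x xN; pose z : full_shift G S := fun h => val (x h) 1%g.
have zE g h : (exhaustion A n `|` F) h -> shift G S g z h = val (x g) h.
  by move=> /NK /(_ x xN g); rewrite mul1g.
have Xz : X z.
  rewrite defX => g.
  have -> : pattern (shift G S g z) = pattern (F := F) (shift G S 1%g (val (x g))).
    apply/funext => f; rewrite act1 /pattern zE//; right; exact: set_valP.
  by have := set_mem (valP (x g)); rewrite {1}defX; apply.
exists (SigSub (mem_set Xz)) => g; apply: n_eps => h hn /=.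
by apply: zE; left.
Qed.

End FiniteTypeToPOTP.

(** * Subshifts with POTP are of finite type *)

Section POTPToFiniteType.
Variables (R : realType) (G : groupType) (S : finType).
Variables (A : set G) (finA : finite_set A) (genA : generates A).
Variables (X : set (full_shift G S)) (invX : invariant_set (shift G S) X).
Hypothesis closedX : closed X.
Variables (d : X -> X -> R) (compat_d : compatible_metric d).
Let T := restrict_action invX.

Let E_le := @exhaustion_le _ A.
Let E_finite n := @exhaustion_finite _ A n finA.
Let E_cover h := @exhaustion_cover _ A h genA.

Lemma compatible_ball_cylinder (x : X) (eps : R) : 0 < eps ->
  exists n, forall y : X,
    agree (exhaustion A n) (val x) (val y) -> d x y < eps.
Proof.
move=> eps0; apply/(nbhs_subshift_cylinder E_le E_finite E_cover x).
by apply/compat_d.2; exists eps.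
Qed.

(** The coordinate at the identity is locally constant, and a continuous map
    from a compact metric space is uniformly continuous. *)
Lemma uniform_coordinate : exists2 eps : R, 0 < eps &
  forall x y : X, d x y < eps -> val x 1%g = val y 1%g.
Proof.
have [[_ _ _ d_triangle] d_nbhs] := compat_d.
suff [n nP] : exists n, forall x y : X,
    d x y < n.+1%:R^-1 -> val x 1%g = val y 1%g.
  by exists n.+1%:R^-1; [rewrite invr_gt0 ltr0n | exact: nP].
apply: (subshift_uniform E_finite (P := fun n (x : X) =>
  forall y, d x y < n.+1%:R^-1 -> val x 1%g = val y 1%g) closedX) => x.
have [eps eps0 epsP] : exists2 eps : R, 0 < eps &
    [set y | d x y < eps] `<=` [set y | val x 1%g = val y 1%g].
  apply/d_nbhs/(nbhs_subshift_cylinder E_le E_finite E_cover).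
  by exists 0%N => y; apply; left.
have eps20 : 0 < eps / 2 by rewrite divr_gt0.
have [m m_eps] := compatible_ball_cylinder x eps20.
have [p p_eps] := ltr_add_invr eps20.
(* m puts y within eps / 2 of x, and p puts y' within eps / 2 of y. *)
exists (maxn m p) => y xy q; rewrite geq_max => /andP[mq pq] y' yy'.
have dxy : d x y < eps / 2.
  by apply: m_eps => h hm; apply: xy; apply: E_le hm; exact: leq_maxl.
have dyy' : d y y' < eps / 2.
  apply: lt_le_trans yy' _; apply: le_trans (ltW p_eps); rewrite add0r.
  by rewrite lef_pV2 ?posrE ?ltr0n// ler_nat.
rewrite -(epsP y) ?(epsP y') //=.
  by rewrite (le_lt_trans (d_triangle x y y'))// [eps]splitr ltrD.
by rewrite (lt_trans dxy)// gtr_pMr ?invf_lt1 ?ltr1n.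
Qed.

(** Uniform continuity of the identity from the uniformity of cylinders to that
    of [d]. *)
Lemma uniform_cylinder (delta : R) : 0 < delta -> exists n,
  forall x y : X, agree (exhaustion A n) (val x) (val y) -> d x y < delta.
Proof.
have [[_ _ d_sym d_triangle] _] := compat_d.
move=> delta0; apply: (subshift_uniform E_finite
  (P := fun n (x : X) => forall y, agree (exhaustion A n) (val x) (val y) ->
    d x y < delta) closedX) => x.
have delta20 : 0 < delta / 2 by rewrite divr_gt0.
have [n n_delta] := compatible_ball_cylinder x delta20.
exists n => y xy m nm y' yy'.
rewrite (le_lt_trans (d_triangle y x y'))// [delta]splitr d_sym ltrD// n_delta//.
by move=> h hn; rewrite xy// yy'//; exact: E_le nm _ hn.
Qed.

Lemma POTP_finite_type : POTP_wrt T d A -> finite_type X.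
Proof.
move=> potp; have [eps eps0 eps1] := uniform_coordinate.
have [delta delta0 trace] := potp _ eps0.
have [n n_delta] := uniform_cylinder delta0.
pose K := exhaustion A n.
pose F := K `|` [set (p.1 * p.2)%g | p in K `*` A].
pose P := [set pattern (F := F) (val x) | x in [set: X]].
exists F, P; split.
- rewrite finite_setU; split; first exact: E_finite.
  by apply: finite_image; apply: finite_setX => //; exact: E_finite.
- by exists 1%g; left; exact: exhaustion1.
apply/seteqP; split=> [x Xx g|x xP].
  by exists (SigSub (mem_set (invX g Xx))).
(* The pseudo-orbit: points of X that look like the translates of x on F. *)
have /choice[o oP] : forall g, exists y : X, agree F (val y) (shift G S g x).
  move=> g; have [y _ yx] := xP g; exists y => h Fh.
  by have := congr1 (fun p => p (SigSub (mem_set Fh))) yx.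
have [z zo] : exists z : X, forall g, d (T g z) (o g) < eps.
  apply: trace => a g Aa; apply: n_delta => k Kk /=.
  have Fka : F (k * a)%g by right; exists (k, a).
  have Fk : F k by left.
  by rewrite /shift_fun (oP g _ Fka) (oP (a * g)%g _ Fk) /= /shift_fun mulgA.
suff -> : x = val z by exact: set_mem (valP z).
apply/funext => g; have /eps1 := zo g.
rewrite oP /=; last by left; exact: exhaustion1.
by rewrite /shift_fun !mul1g.
Qed.

End POTPToFiniteType.

Theorem theorem3p2 (R : realType) (G : groupType) (S : finType)
    (hG : finitely_generated G) (hS : (0 < #|S|)%N)
    (X : set (full_shift G S)) (hX : subshift X) :
  finite_type X <-> POTP R (restrict_action (proj2 hX)).
Proof.
split=> [Xft|[d [A [compat_d finA genA potp]]]].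
  by have [A [finA genA]] := hG; exact: (finite_type_POTP R finA genA (proj2 hX) Xft).
exact: (POTP_finite_type finA genA (proj1 hX) compat_d potp).
Qed.
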